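(* Let $F$ be a graph. If $(K_2,F)$ is a forcing pair, then $(K_3,F^{\triangle})$ is a forcing pair as well.
   Context: Graphs are finite, simple and undirected, with nonempty vertex set. For graphs $F$ and $G$, $\hom(F,G)$ is the number of graph homomorphisms from $F$ to $G$, and $t(F,G)=\hom(F,G)/|V(G)|^{|V(F)|}$ is the homomorphism density; $e(F)$ is the number of edges of $F$. $K_2$ is a single edge and $K_3$ is the triangle. For a graph $F$, the graph $F^{\triangle}$ is obtained from $F$ by replacing every edge by a triangle, each of which introduces a new vertex: for every edge $uv\in E(F)$ one adds a new vertex $w_{uv}$ (distinct for distinct edges) together with the edges $uw_{uv}$ and $vw_{uv}$, keeping the edge $uv$. For $X,Y\subseteq V$, $e_G(X,Y)$ is the number of ordered pairs $(x,y)\in X\times Y$ with $xy\in E$ (so edges contained in $X\cap Y$ are counted twice). For $\varepsilon>0$ and $p\in(0,1]$, a graph $G=(V,E)$ is called $(\varepsilon,p)$-quasirandom if for all $X,Y\subseteq V$ we have $\bigl|e_G(X,Y)-p|X||Y|\bigr|\le\varepsilon|V|^2$. A pair of graphs $(F_1,F_2)$ is forcing if for every $p\in(0,1]$ and $\varepsilon>0$ there is some $\delta>0$ such that every graph $G$ with $t(F_1,G)\ge(1-\delta)p^{e(F_1)}$ and $t(F_2,G)\le(1+\delta)p^{e(F_2)}$ is $(\varepsilon,p)$-quasirandom. *)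

(* Defs.v *)
From HB Require Import structures.
From mathcomp Require Import all_boot all_order all_algebra.
From mathcomp Require Import reals.

Set Implicit Arguments.
Unset Strict Implicit.
Unset Printing Implicit Defensive.

Import Order.TTheory GRing.Theory Num.Theory.

Record sgraph := SGraph {
  vertex :> finType;
  adj : rel vertex;
  adj_sym : symmetric adj;
  adj_irrefl : irreflexive adj;
  vertex_gt0 : 0 < #|vertex| }.

Definition edges (G : sgraph) : {set {set G}} :=
  [set [set u; v] | u in G, v in G & adj u v].

Definition nb_edges (G : sgraph) : nat := #|edges G|.

Section Complete.
Variables (T : finType) (T_gt0 : 0 < #|T|).

Definition complete_rel : rel T := fun u v => u != v.

Fact complete_sym : symmetric complete_rel.
Proof. by move=> u v; rewrite /complete_rel eq_sym. Qed.

Fact complete_irrefl : irreflexive complete_rel.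
Proof. by move=> u; rewrite /complete_rel eqxx. Qed.

Definition complete : sgraph := SGraph complete_sym complete_irrefl T_gt0.
End Complete.

Fact ord_card_gt0 n : 0 < #|'I_n.+1|.
Proof. by rewrite card_ord. Qed.

Definition K2 : sgraph := complete (ord_card_gt0 1).
Definition K3 : sgraph := complete (ord_card_gt0 2).

Section Triangle.
Variable F : sgraph.

(* [inl u] is an original vertex, [inr e] the new vertex attached to edge e. *)
Definition triangle_vertex : finType := (F + {e : {set F} | e \in edges F})%type.

Definition triangle_rel : rel triangle_vertex := fun x y =>
  match x, y with
  | inl u, inl v => adj u v
  | inl u, inr e => u \in val e
  | inr e, inl u => u \in val e
  | inr _, inr _ => false
  end.

Fact triangle_sym : symmetric triangle_rel.
Proof. by move=> [u|e] [v|f] //=; apply: adj_sym. Qed.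

Fact triangle_irrefl : irreflexive triangle_rel.
Proof. by move=> [u|e] //=; apply: adj_irrefl. Qed.

Fact triangle_gt0 : 0 < #|triangle_vertex|.
Proof. by rewrite card_sum addn_gt0 vertex_gt0. Qed.

Definition triangle : sgraph := SGraph triangle_sym triangle_irrefl triangle_gt0.
End Triangle.

Definition is_hom (F G : sgraph) (f : F -> G) : bool :=
  [forall u, forall v, adj u v ==> adj (f u) (f v)].

Definition nb_hom (F G : sgraph) : nat := #|[set f : {ffun F -> G} | is_hom f]|.

(* Ordered pairs, so edges inside the intersection of X and Y count twice. *)
Definition e_between (G : sgraph) (X Y : {set G}) : nat :=
  #|[set xy : G * G | [&& xy.1 \in X, xy.2 \in Y & adj xy.1 xy.2]]|.

Local Open Scope ring_scope.

Definition hom_density (R : realType) (F G : sgraph) : R :=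
  (nb_hom F G)%:R / #|G|%:R ^+ #|F|.

Definition quasirandom (R : realType) (eps p : R) (G : sgraph) : Prop :=
  forall X Y : {set G},
    `|(e_between X Y)%:R - p * #|X|%:R * #|Y|%:R| <= eps * #|G|%:R ^+ 2.

Definition forcing (R : realType) (F1 F2 : sgraph) : Prop :=
  forall p eps : R, 0 < p <= 1 -> 0 < eps ->
  exists2 delta : R, 0 < delta &
    forall G : sgraph,
      hom_density R F1 G >= (1 - delta) * p ^+ nb_edges F1 ->
      hom_density R F2 G <= (1 + delta) * p ^+ nb_edges F2 ->
      quasirandom eps p G.

(* Main.v *)
(**
Let [W] be the adjacency matrix of [G], [d x y] the codegree density of [x] and
[y], and [U = W d]. Then t(K3, G) = t(K2, U) and t(F^triangle, G) = t(F, U).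
A blow-up of [G] in which every pair of parts carries a quasirandom bipartite
graph of density [U x y] is a genuine graph with nearly these densities, so the
forcing pair (K2, F) shows that [U] is close to [c = p^3] in the cut norm.

It remains to deduce [W ~ p] from [W d ~ c]. In the limit, where [W d = c]
pointwise, Cauchy-Schwarz for [d(y,.)] with respect to the measure [W(x,.)] gives
[W^3(x,y) >= W(x,y) deg(x)^2], [W^3] being the operator cube. The average over
[(x,y)] of the symmetrised right side is at least that of
[W(x,y) deg(x) deg(y)], which equals the average of [W^3]. So equality holds
everywhere, forcing constant degrees and constant codegrees. Multiplied out, the
argument only substitutes [c] for [W d] under weights that are products of a
function of [x] and a function of [y], which is all the cut norm controls.
*)
Require Import Defs.
From mathcomp Require Import all_boot all_order all_algebra.
From mathcomp Require Import reals.
From mathcomp Require Import zify ring lra.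

Set Implicit Arguments.
Unset Strict Implicit.
Unset Printing Implicit Defensive.

Import Order.TTheory GRing.Theory Num.Theory.

(** * Counting homomorphisms *)

Lemma card_set_sum (T : finType) (P : pred T) : #|[set x | P x]| = \sum_x (P x : nat).
Proof. by rewrite cardsE -sum1_card big_mkcond; apply: eq_bigr => x _; rewrite unfold_in; case: (P x). Qed.

Lemma sum_ffun_pair (I A B : finType) (F : {ffun I -> A * B} -> nat) :
  \sum_f F f =
  \sum_(g : {ffun I -> A}) \sum_(h : {ffun I -> B}) F [ffun i => (g i, h i)].
Proof.
rewrite pair_bigA/=.
rewrite (reindex (fun p : {ffun I -> A} * {ffun I -> B} => [ffun i => (p.1 i, p.2 i)]))//.
exists (fun f : {ffun I -> A * B} => ([ffun i => (f i).1], [ffun i => (f i).2])) => [[g h]|f] _.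
  by congr pair; apply/ffunP => i; rewrite !ffunE.
by apply/ffunP => i; rewrite !ffunE; case: (f i).
Qed.

Lemma sum_ffun_sumtype (I J T : finType) (F : {ffun I + J -> T} -> nat) :
  \sum_f F f = \sum_(g : {ffun I -> T}) \sum_(h : {ffun J -> T})
    F [ffun x => match x with inl i => g i | inr j => h j end].
Proof.
rewrite pair_bigA/=.
rewrite (reindex (fun p : {ffun I -> T} * {ffun J -> T} =>
  [ffun x : I + J => match x with inl i => p.1 i | inr j => p.2 j end]))//.
exists (fun f : {ffun I + J -> T} => ([ffun i => f (inl i)], [ffun i => f (inr i)])).
  by move=> [g h] _; congr pair; apply/ffunP => i; rewrite !ffunE.
by move=> f _; apply/ffunP => -[i|j]; rewrite !ffunE.
Qed.

Lemma card_ffun_family (I T : finType) (Q : I -> {set T}) :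
  \sum_(f : {ffun I -> T}) ([forall i, f i \in Q i] : nat) = \prod_i #|Q i|.
Proof.
under [RHS]eq_bigr do rewrite -sum1_card.
rewrite (bigA_distr_big_dep (fun i => mem (Q i)))/= [RHS]big_mkcond/=.
apply: eq_bigr => f _; rewrite big1_eq; case: ifP => [/familyP fQ|/familyP fQ].
  by rewrite (_ : [forall i, _])//; apply/forallP.
by case: forallP.
Qed.

Lemma ffact_le_expn M k : M ^_ k <= M ^ k.
Proof. by elim: k => // k IH; rewrite ffactnSr expnSr leq_mul// leq_subr. Qed.

(** Divided by [M * M ^ k]: at most a proportion [k ^ 2 / M] of the maps from a [k]-set to an
    [M]-set fail to be injective. This bounds the error of the blow-up. *)
Lemma ffact_lower M k : M * M ^ k <= M * M ^_ k + k * k * M ^ k.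
Proof.
elim: k => [|k IH]; first by rewrite ffactn0 expn0; lia.
have le_ffact := ffact_le_expn M k.
rewrite ffactnSr expnS.
move: (M ^ k) (M ^_ k) IH le_ffact => X Y IH YX.
(* The subtraction is truncated, but the bound also holds when [M < k]. *)
have h1 : Y * M <= Y * (M - k) + k * Y by rewrite (mulnC k) -mulnDr leq_mul//; lia.
have h2 : M * (Y * M) <= M * (Y * (M - k)) + M * (k * X).
  by rewrite -mulnDr leq_mul// (leq_trans h1)// leq_add2l leq_mul.
have h3 : M * (M * X) <= M * (M * Y + k * k * X) by rewrite leq_mul.
nia.
Qed.

(** * Orientations and edge counts *)

Section Edges.
Variable F : sgraph.

Section Orient.
Variables (m : nat) (a : F -> 'I_m).
Hypothesis a_inj : injective a.

(** Each edge is listed once, directed towards the larger label, so products over unordered edges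
    become products over pairs. In the blow-up the source of such a pair is the vertex that
    draws. *)
Definition oriented : {set F * F} := [set vw | adj vw.1 vw.2 && (a vw.1 < a vw.2)].

Definition edge_of (vw : F * F) : {set F} := [set vw.1; vw.2].

Lemma edge_of_inj : {in oriented &, injective edge_of}.
Proof.
move=> [v w] [v' w']; rewrite !inE /= => /andP[_ lt] /andP[_ lt'] E.
have := set21 v w; rewrite [[set v; w]]E !inE => /orP[/eqP ev|/eqP ev].
  have := set22 v w; rewrite [[set v; w]]E !inE => /orP[/eqP ew|/eqP ew].
    by move: lt; rewrite ev ew ltnn.
  by rewrite ev ew.
have := set22 v w; rewrite [[set v; w]]E !inE => /orP[/eqP ew|/eqP ew].
  by move: lt lt'; rewrite ev ew => /ltn_trans/[apply]; rewrite ltnn.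
by move: lt; rewrite ev ew ltnn.
Qed.

Lemma edges_oriented : edges F = edge_of @: oriented.
Proof.
apply/setP => e; apply/imset2P/imsetP => [[u v _]|[[u v]]].
  rewrite inE => /andP[_ uv] ->.
  have /negP nuv : u != v by apply: contraTneq uv => ->; rewrite adj_irrefl.
  case: (ltngtP (a u) (a v)) => [lt|lt|/val_inj/a_inj/eqP//].
    by exists (u, v) => //; rewrite inE uv.
  exists (v, u); first by rewrite inE adj_sym uv.
  by rewrite /edge_of setUC.
by rewrite inE => /andP[uv _] ->; exists u v => //; rewrite inE.
Qed.

Lemma prod_edges (f : {set F} -> nat) :
  \prod_(e in edges F) f e = \prod_(vw in oriented) f [set vw.1; vw.2].
Proof. by rewrite edges_oriented big_imset //; exact: edge_of_inj. Qed.

Lemma card_oriented : #|oriented| = nb_edges F.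
Proof. by rewrite /nb_edges edges_oriented card_in_imset //; exact: edge_of_inj. Qed.

End Orient.

Lemma sum_adj : \sum_(u : F) \sum_(v : F) (adj u v : nat) = 2 * nb_edges F.
Proof.
pose a : F -> 'I_#|F| := enum_rank.
have ai : injective a by exact: enum_rank_inj.
have nbE : nb_edges F = \sum_(u : F) \sum_(v : F) (adj u v && (a u < a v) : nat).
  by rewrite -(card_oriented ai) card_set_sum pair_bigA.
rewrite mul2n -addnn {1}nbE nbE [X in _ = _ + X]exchange_big -big_split/=.
apply: eq_bigr => u _; rewrite -big_split/=; apply: eq_bigr => v _.
rewrite [adj v u]adj_sym; case uv: (adj u v) => //=.
case: (ltngtP (a u) (a v)) => // E; have {}E := ai _ _ (val_inj E).
by move: uv; rewrite E adj_irrefl.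
Qed.

Lemma card_edge (e : {set F}) : e \in edges F -> #|e| = 2.
Proof.
case/imset2P => u v _; rewrite inE => /andP[_ uv] ->; rewrite cards2.
by case: eqP uv => // ->; rewrite adj_irrefl.
Qed.

End Edges.

(** Among ordered adjacent pairs, [2 * nb_edges F] are old, and the [2 * nb_edges F] incidences of a
    vertex with an edge occur in both orders. *)
Lemma nb_edges_triangle F : nb_edges (triangle F) = 3 * nb_edges F.
Proof.
have incidences : \sum_(e : {e : {set F} | e \in edges F}) \sum_(u : F) (u \in val e : nat)
    = 2 * nb_edges F.
  transitivity (\sum_(e : {e : {set F} | e \in edges F}) 2).
    by apply: eq_bigr => e _; rewrite -card_set_sum cardsE card_edge ?(valP e).
  by rewrite sum_nat_const card_sig mulnC.
apply/eqP; rewrite -(eqn_pmul2l (isT : 0 < 2)) -sum_adj big_sumType/=.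
under eq_bigr do rewrite big_sumType/=.
under [X in _ + X]eq_bigr do rewrite big_sumType/=.
rewrite !big_split/= sum_adj exchange_big/= incidences big1 ?big1 //; apply/eqP; lia.
Qed.

Lemma nb_edges_K2 : nb_edges K2 = 1.
Proof.
apply/eqP; rewrite -(eqn_pmul2l (isT : 0 < 2)) -sum_adj.
by rewrite !big_ord_recl !big_ord0.
Qed.

Lemma nb_edges_K3 : nb_edges K3 = 3.
Proof.
apply/eqP; rewrite -(eqn_pmul2l (isT : 0 < 2)) -sum_adj.
by rewrite !big_ord_recl !big_ord0.
Qed.

(** * Homomorphisms from [K2], [K3] and [triangle F] *)

Definition common (G : sgraph) (x y : G) : {set G} := [set z | adj x z && adj z y].

Lemma common_sym (G : sgraph) (x y : G) : common x y = common y x.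
Proof. by apply/setP => z; rewrite !inE andbC adj_sym [adj x z]adj_sym. Qed.

Lemma is_homP (F G : sgraph) (f : F -> G) :
  reflect (forall u v, adj u v -> adj (f u) (f v)) (is_hom f).
Proof.
apply: (iffP forallP) => [H u v|H u]; first by move/forallP: (H u) => /(_ v)/implyP.
by apply/forallP => v; apply/implyP; exact: H.
Qed.

Lemma nb_hom_sum (F G : sgraph) : nb_hom F G = \sum_(f : {ffun F -> G}) (is_hom f : nat).
Proof. exact: card_set_sum. Qed.

Lemma sum_ffun_ord (n : nat) (T : finType) (H : {ffun 'I_n.+1 -> T} -> nat) :
  \sum_f H f = \sum_x \sum_(g : {ffun 'I_n -> T})
    H [ffun i => if unlift ord0 i is Some j then g j else x].
Proof.
rewrite pair_bigA/= (reindex (fun p : T * {ffun 'I_n -> T} =>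
  [ffun i : 'I_n.+1 => if unlift ord0 i is Some j then p.2 j else p.1]))//.
exists (fun f : {ffun 'I_n.+1 -> T} => (f ord0, [ffun j => f (lift ord0 j)])).
  move=> [x g] _; congr pair; first by rewrite ffunE unlift_none.
  by apply/ffunP => i; rewrite !ffunE liftK.
move=> f _; apply/ffunP => i; rewrite !ffunE.
by case: unliftP => [j ->|->]; rewrite ?ffunE.
Qed.

Lemma sum_ffun_ord0 (T : finType) (H : {ffun 'I_0 -> T} -> nat) (f0 : {ffun 'I_0 -> T}) :
  \sum_f H f = H f0.
Proof.
by rewrite (big_pred1 f0)// => f; apply/esym/eqP/ffunP => -[].
Qed.

Lemma nb_hom_K2 (G : sgraph) : nb_hom K2 G = \sum_(x : G) \sum_(y : G) (adj x y : nat).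
Proof.
have f0 : {ffun 'I_0 -> G} by apply: finfun => -[].
rewrite nb_hom_sum sum_ffun_ord; apply: eq_bigr => x _.
rewrite sum_ffun_ord; apply: eq_bigr => y _; rewrite (sum_ffun_ord0 _ f0).
congr nat_of_bool; apply/is_homP/idP => [H|xy u v].
  by have := H ord0 (lift ord0 ord0) isT; rewrite !ffunE liftK unlift_none ffunE unlift_none.
rewrite !ffunE; case: unliftP => [i ->|->]; case: unliftP => [j ->|->] //; rewrite !ffunE.
- by rewrite !ord1 /= /complete_rel eqxx.
- by move=> _; rewrite !ord1 unlift_none adj_sym.
- by move=> _; rewrite !ord1 unlift_none.
Qed.

Lemma nb_hom_K3 (G : sgraph) :
  nb_hom K3 G = \sum_(x : G) \sum_(y : G) adj x y * #|common x y|.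
Proof.
have f0 : {ffun 'I_0 -> G} by apply: finfun => -[].
rewrite nb_hom_sum sum_ffun_ord; apply: eq_bigr => x _.
rewrite sum_ffun_ord; apply: eq_bigr => y _.
rewrite card_set_sum big_distrr/= sum_ffun_ord.
apply: eq_bigr => z _; rewrite (sum_ffun_ord0 _ f0) mulnb; congr nat_of_bool.
set f := finfun _.
have [fx fy fz] : [/\ f ord0 = x, f (lift ord0 ord0) = y & f (lift ord0 (lift ord0 ord0)) = z].
  by split; rewrite /f ?ffunE ?liftK ?unlift_none ?ffunE ?liftK ?unlift_none ?ffunE ?unlift_none.
apply/is_homP/idP => [H|/and3P[xy xz zy] u v].
  have := H ord0 (lift ord0 ord0) isT.
  have := H ord0 (lift ord0 (lift ord0 ord0)) isT.
  have := H (lift ord0 (lift ord0 ord0)) (lift ord0 ord0) isT.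
  by rewrite fx fy fz => -> -> ->.
have ord3 (i : 'I_3) : [\/ i = ord0, i = lift ord0 ord0 | i = lift ord0 (lift ord0 ord0)].
  by case: i => [[|[|[|//]]] ?]; [apply: Or31|apply: Or32|apply: Or33]; exact: val_inj.
by case: (ord3 u) => ->; case: (ord3 v) => -> // _;
  rewrite ?fx ?fy ?fz // adj_sym.
Qed.

(** The new vertices are pairwise non-adjacent, so once [phi] is fixed on [F] their images are
    chosen independently, each adjacent to the images of both ends of its edge. *)
Lemma nb_hom_triangle (F G : sgraph) :
  nb_hom (triangle F) G = \sum_(phi : {ffun F -> G}) (is_hom phi : nat) *
    \prod_(e in edges F) #|[set z | [forall u in e, adj (phi u) z]]|.
Proof.
rewrite nb_hom_sum sum_ffun_sumtype; apply: eq_bigr => phi _.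
have -> : \prod_(e in edges F) #|[set z | [forall u in e, adj (phi u) z]]| =
    \prod_(e : {e : {set F} | e \in edges F}) #|[set z | [forall u in val e, adj (phi u) z]]|.
  exact: (big_sub (mem (edges F))).
rewrite -card_ffun_family big_distrr/=; apply: eq_bigr => psi _.
rewrite mulnb; congr nat_of_bool.
apply/is_homP/andP => [H|[/is_homP phom /forallP psiP] [u|e] [v|e']].
- split; first by apply/is_homP => u v uv; have := H (inl u) (inl v) uv; rewrite !ffunE.
  apply/forallP => e; rewrite inE; apply/forall_inP => u ue.
  by have := H (inl u) (inr e) ue; rewrite !ffunE.
- by rewrite !ffunE; exact: phom.
- by rewrite !ffunE => /= ue; move: (psiP e'); rewrite inE => /forall_inP; apply.
- rewrite !ffunE => /= ue; rewrite adj_sym.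
  by move: (psiP e); rewrite inE => /forall_inP; apply.
- by [].
Qed.

Lemma nb_hom_triangle_oriented (F G : sgraph) m (a : F -> 'I_m) : injective a ->
  nb_hom (triangle F) G = \sum_(phi : {ffun F -> G}) (is_hom phi : nat) *
    \prod_(vw in oriented a) #|common (phi vw.1) (phi vw.2)|.
Proof.
move=> ai; rewrite nb_hom_triangle; apply: eq_bigr => phi _; congr (_ * _).
rewrite (prod_edges ai); apply: eq_bigr => -[v w] _ /=.
apply: eq_card => z; rewrite !inE; apply/forall_inP/andP => [H|[vz zw] u].
  by rewrite H ?set21// adj_sym H ?set22.
by rewrite !inE => /orP[] /eqP-> //; rewrite adj_sym.
Qed.

(** * The blow-up *)

Section Blowup.
Variables (G : sgraph) (m : nat).

Definition label : finType := ('I_m.+1 * {ffun 'I_m.+1 -> G})%type.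
Definition blowup_vertex : finType := (G * label)%type.

(* The label with the smaller first component draws a vertex of [G] for the pair.
   Once the first components are distinct, the draws for different pairs are
   independent and uniform, so this explicit graph has exactly the statistics of
   a random blow-up with edge probabilities [adj x y * #|common x y| / #|G|]. *)
Definition linked (i j : label) (C : {set G}) : bool :=
  (i.1 < j.1) && (i.2 j.1 \in C) || (j.1 < i.1) && (j.2 i.1 \in C).

Definition blowup_rel : rel blowup_vertex := fun u v =>
  adj u.1 v.1 && linked u.2 v.2 (common u.1 v.1).

Lemma blowup_sym : symmetric blowup_rel.
Proof. by move=> u v; rewrite /blowup_rel /linked adj_sym common_sym orbC. Qed.

Lemma blowup_irrefl : irreflexive blowup_rel.
Proof. by move=> u; rewrite /blowup_rel adj_irrefl. Qed.

Lemma card_label : #|label| = m.+1 * #|G| ^ m.+1.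
Proof. by rewrite card_prod card_ffun !card_ord. Qed.

Lemma label_gt0 : 0 < #|label|.
Proof. by rewrite card_label muln_gt0 expn_gt0 vertex_gt0. Qed.

Lemma blowup_gt0 : 0 < #|blowup_vertex|.
Proof. by rewrite card_prod muln_gt0 vertex_gt0 label_gt0. Qed.

Definition blowup : sgraph := SGraph blowup_sym blowup_irrefl blowup_gt0.

(** A coordinate of a uniformly random function is uniform; cross-multiplied to stay in [nat]. *)
Lemma card_eval (b : 'I_m.+1) (C : {set G}) :
  (\sum_(g : {ffun 'I_m.+1 -> G}) (g b \in C : nat)) * #|G| = #|C| * #|G| ^ m.+1.
Proof.
pose Q b' := if b' == b then C else setT.
have -> : (\sum_(g : {ffun 'I_m.+1 -> G}) (g b \in C : nat)) = \prod_b' #|Q b'|.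
  rewrite -card_ffun_family; apply: eq_bigr => g _; congr nat_of_bool.
  apply/idP/forallP => [gC b'|/(_ b)]; last by rewrite /Q eqxx.
  by rewrite /Q; case: eqP => [->|]; rewrite ?inE.
rewrite (bigD1 b)//= {1}/Q eqxx -mulnA; congr (_ * _).
rewrite (eq_bigr (fun=> #|G|)) => [|b' /negbTE nb]; last by rewrite /Q nb cardsT.
by rewrite prod_nat_const cardC1 card_ord -expnSr.
Qed.

(** Two random labels have distinct positions with probability [m / m.+1], and the draw then falls
    in [C] with probability [#|C| / #|G|]. *)
Lemma card_linked (C : {set G}) :
  m.+1 * #|G| * (\sum_(i : label) \sum_(j : label) (linked i j C : nat)) =
  m * #|C| * #|label| ^ 2.
Proof.
set D := #|G| ^ m.+1.
have key (a b : 'I_m.+1) : #|G| * (\sum_(g : {ffun 'I_m.+1 -> G})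
    \sum_(h : {ffun 'I_m.+1 -> G}) (linked (a, g) (b, h) C : nat)) =
    (a != b) * (#|C| * D ^ 2).
  rewrite /linked/= -val_eqE/=; case: (ltngtP a b) => ab.
  - under eq_bigr do under eq_bigr do rewrite andTb andFb orbF.
    under eq_bigr do rewrite sum_nat_const card_ffun card_ord.
    rewrite -big_distrr/= mulnCA [#|G| * _]mulnC card_eval -/D.
    by rewrite mul1n mulnCA expnS expn1.
  - under eq_bigr do under eq_bigr do rewrite andTb andFb orFb.
    rewrite sum_nat_const card_ffun card_ord.
    by rewrite mulnCA [#|G| * _]mulnC card_eval -/D mul1n mulnCA expnS expn1.
  - rewrite mul0n; apply/eqP; rewrite muln_eq0; apply/orP; right; apply/eqP.
    by apply: big1 => g _; apply: big1.
have -> : (\sum_(i : label) \sum_(j : label) (linked i j C : nat)) =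
    \sum_a \sum_b \sum_(g : {ffun 'I_m.+1 -> G}) \sum_(h : {ffun 'I_m.+1 -> G})
      (linked (a, g) (b, h) C : nat).
  rewrite -(pair_bigA _ (fun a g => \sum_(j : label) (linked (a, g) j C : nat)))/=.
  apply: eq_bigr => a _; rewrite [RHS]exchange_big; apply: eq_bigr => g _.
  by rewrite -(pair_bigA _ (fun b h => (linked (a, g) (b, h) C : nat))).
rewrite -mulnA big_distrr/=.
under eq_bigr do rewrite big_distrr/=.
under eq_bigr do under eq_bigr do rewrite key.
have cnt (a : 'I_m.+1) : \sum_b ((a != b) * (#|C| * D ^ 2)) = m * (#|C| * D ^ 2).
  rewrite -big_distrl/=; congr (_ * _).
  rewrite -(card_set_sum (fun b => a != b)) cardsE.
  transitivity #|predC1 a|; last by rewrite cardC1 card_ord.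
  by apply: eq_card => b; rewrite !inE eq_sym.
under eq_bigr do rewrite cnt.
by rewrite sum_nat_const card_ord card_label -/D; lia.
Qed.

(** Unions of fibres are the test sets from which the cut bound on [G] is recovered. *)
Lemma e_between_blowup (X Y : {set G}) :
  m.+1 * #|G| * e_between (G := blowup) [set u | u.1 \in X] [set v | v.1 \in Y] =
  m * #|label| ^ 2 * \sum_(x in X) \sum_(y in Y) adj x y * #|common x y|.
Proof.
have -> : e_between (G := blowup) [set u | u.1 \in X] [set v | v.1 \in Y] =
    \sum_(x in X) \sum_(y in Y) \sum_(i : label) \sum_(j : label)
      adj x y * linked i j (common x y).
  pose E x i y j := [&& x \in X, y \in Y, adj x y & linked i j (common x y)].
  transitivity (\sum_x \sum_(i : label) \sum_y \sum_(j : label) (E x i y j : nat)).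
    rewrite /e_between card_set_sum pair_bigA/=.
    under [RHS]eq_bigr do rewrite pair_bigA/=.
    rewrite pair_bigA/=; apply: eq_bigr => -[[x i] [y j]] _; rewrite !inE/=.
    by [].
  rewrite [RHS]big_mkcond/=; apply: eq_bigr => x _; rewrite exchange_big/=.
  case: ifPn => xX; last first.
    by do 3!(apply: big1 => ? _); rewrite /E (negbTE xX).
  rewrite [RHS]big_mkcond/=; apply: eq_bigr => y _.
  case: ifPn => yY; last first.
    by do 2!(apply: big1 => ? _); rewrite /E (negbTE yY) andbF.
  by apply: eq_bigr => i _; apply: eq_bigr => j _; rewrite /E xX yY mulnb.
rewrite big_distrr/= [RHS]big_distrr/=; apply: eq_bigr => x _.
rewrite big_distrr/= [RHS]big_distrr/=; apply: eq_bigr => y _.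
under eq_bigr do rewrite -big_distrr/=.
rewrite -big_distrr/= mulnCA; have /= -> := card_linked (common x y).
by rewrite [RHS]mulnCA mulnAC.
Qed.


(** * Homomorphisms into the blow-up *)

Section HomBlowup.
Variable F : sgraph.
Let D := #|G| ^ m.+1.

(* The values that the vertex drawn by [v] for a partner at position [b] may take
   in a homomorphism; unrestricted if no out-neighbour of [v] sits at [b]. *)
Definition allowed (phi : {ffun F -> G}) (a : F -> 'I_m.+1) (v : F) (b : 'I_m.+1) : {set G} :=
  [set z | [forall w, [&& adj v w, a v < a w & a w == b] ==> (z \in common (phi v) (phi w))]].

Lemma prod_oriented (a : F -> 'I_m.+1) (f : F -> F -> nat) :
  \prod_(vw in oriented a) f vw.1 vw.2 = \prod_v \prod_(w | adj v w && (a v < a w)) f v w.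
Proof. by rewrite pair_big_dep/=; apply: eq_bigl => -[v w]; rewrite inE. Qed.

(** By injectivity of [a] a position [b] carries at most one constraint for [v], so each oriented
    edge turns one factor [#|G|] of [D ^ #|F|] into a number of common neighbours. The power of
    [#|G|] on the left restores these factors. *)
Lemma prod_allowed (phi : {ffun F -> G}) (a : F -> 'I_m.+1) : injective a ->
  #|G| ^ nb_edges F * \prod_v \prod_b #|allowed phi a v b| =
  D ^ #|F| * \prod_(vw in oriented a) #|common (phi vw.1) (phi vw.2)|.
Proof.
move=> ai; rewrite -(card_oriented ai) -prod_nat_const.
rewrite (prod_oriented a (fun _ _ => #|G|)).
rewrite (prod_oriented a (fun v w => #|common (phi v) (phi w)|)).
rewrite -[D ^ _]prod_nat_const -!big_split/=; apply: eq_bigr => v _.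
pose P w := adj v w && (a v < a w).
pose im := a @: [set w | P w].
have prod_im (f : 'I_m.+1 -> nat) : \prod_(b in im) f b = \prod_(w | P w) f (a w).
  rewrite big_imset/=; first by apply: eq_bigl => w; rewrite inE.
  by move=> ? ? _ _ /ai.
have -> : D = \prod_(b < m.+1) #|G| by rewrite prod_nat_const card_ord.
rewrite (bigID (mem im))/= [in RHS](bigID (mem im))/= !prod_im -mulnA; congr (_ * _).
rewrite mulnC; congr (_ * _).
  apply: eq_bigr => b bim; rewrite -cardsT; apply: eq_card => z; rewrite !inE.
  apply/forallP => w; apply/implyP => /and3P[vw lt /eqP awb].
  by case/negP: bim; rewrite -awb imset_f// inE /P vw.
apply: eq_bigr => w /andP[vw lt].
apply: eq_card => z; rewrite inE; apply/forallP/idP => [/(_ w)|zC w'].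
  by rewrite vw lt eqxx.
by apply/implyP => /and3P[_ _ /eqP/ai ->].
Qed.

Let hom_of (phi : {ffun F -> G}) (a : {ffun F -> 'I_m.+1})
    (Phi : {ffun F -> {ffun 'I_m.+1 -> G}}) : {ffun F -> blowup} :=
  [ffun v => (phi v, ([ffun v => (a v, Phi v)] : {ffun F -> label}) v)].

(** A homomorphism into the blow-up makes [phi] a homomorphism and puts each draw [Phi v b] into its
    [allowed] set; the draws range independently. *)
Lemma nb_hom_blowup_inj (a : {ffun F -> 'I_m.+1}) : injective a ->
  #|G| ^ nb_edges F * (\sum_phi \sum_Phi (is_hom (hom_of phi a Phi) : nat))
    <= D ^ #|F| * nb_hom (triangle F) G.
Proof.
move=> ai; rewrite (nb_hom_triangle_oriented _ ai) !big_distrr/=.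
apply: leq_sum => phi _.
rewrite [leqRHS]mulnCA -prod_allowed// [leqRHS]mulnCA leq_mul//.
pose Q v := [set g : {ffun 'I_m.+1 -> G} | [forall b, g b \in allowed phi a v b]].
rewrite (eq_bigr (fun v => #|Q v|)); last first.
  by move=> v _; rewrite card_set_sum card_ffun_family.
rewrite -card_ffun_family big_distrr/=; apply: leq_sum => Phi _.
case: is_homP => //= H.
have -> : is_hom phi.
  by apply/is_homP => u v /H; rewrite !ffunE => /andP[].
rewrite mul1n lt0b; apply/forallP => v; rewrite inE; apply/forallP => b.
rewrite inE; apply/forallP => w; apply/implyP => /and3P[vw lt /eqP <-].
by move: (H _ _ vw); rewrite !ffunE => /andP[_] /=; rewrite /linked/= lt ltnNge (ltnW lt)/= orbF.
Qed.

(** Split according to the position map [a]: injective ones are handled by [nb_hom_blowup_inj], for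
    the others every map is counted. *)
Lemma nb_hom_blowup :
  #|G| ^ nb_edges F * nb_hom F blowup <=
  m.+1 ^_ #|F| * (D ^ #|F| * nb_hom (triangle F) G) +
  (m.+1 ^ #|F| - m.+1 ^_ #|F|) * (#|G| ^ nb_edges F * (#|G| ^ #|F| * D ^ #|F|)).
Proof.
have -> : nb_hom F blowup = \sum_(a : {ffun F -> 'I_m.+1}) \sum_phi \sum_Phi
    (is_hom (hom_of phi a Phi) : nat).
  rewrite nb_hom_sum sum_ffun_pair [RHS]exchange_big/=; apply: eq_bigr => phi _.
  by rewrite sum_ffun_pair.
have inj_card : #|[set a : {ffun F -> 'I_m.+1} | injectiveb a]| = m.+1 ^_ #|F|.
  by rewrite card_inj_ffuns card_ord.
have ninj_card : #|~: [set a : {ffun F -> 'I_m.+1} | injectiveb a]| = m.+1 ^ #|F| - m.+1 ^_ #|F|.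
  by rewrite cardsCs setCK inj_card card_ffun card_ord.
rewrite big_distrr/= (bigID (mem [set a : {ffun F -> 'I_m.+1} | injectiveb a]))/=.
apply: leq_add.
  rewrite -inj_card -sum_nat_const; apply: leq_sum => a; rewrite inE => /injectiveP.
  exact: nb_hom_blowup_inj.
rewrite -ninj_card -sum_nat_const big_mkcond/= [leqRHS]big_mkcond/=.
apply: leq_sum => a _; rewrite !inE; case: ifP => // _; rewrite leq_mul//.
rewrite (@leq_trans (\sum_(phi : {ffun F -> G})
   \sum_(Phi : {ffun F -> {ffun 'I_m.+1 -> G}}) 1))//.
  by apply: leq_sum => phi _; apply: leq_sum => Phi _; case: is_hom.
by rewrite !sum_nat_const !card_ffun !card_ord muln1.
Qed.

End HomBlowup.
End Blowup.

Local Open Scope ring_scope.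

(** * Averages and the cut norm *)

Section Mean.
Variables (R : realFieldType) (T : finType).
Implicit Types (f g : T -> R) (k : R).

Definition mean f : R := (\sum_x f x) / #|T|%:R.

Lemma eq_mean f g : f =1 g -> mean f = mean g.
Proof. by move=> fg; rewrite /mean (eq_bigr _ (fun x _ => fg x)). Qed.

Lemma meanD f g : mean (fun x => f x + g x) = mean f + mean g.
Proof. by rewrite /mean big_split mulrDl. Qed.

Lemma meanB f g : mean (fun x => f x - g x) = mean f - mean g.
Proof. by rewrite /mean sumrB mulrBl. Qed.

Lemma meanZ k f : mean (fun x => k * f x) = k * mean f.
Proof. by rewrite /mean -mulr_sumr mulrA. Qed.

Lemma meanZr k f : mean (fun x => f x * k) = mean f * k.
Proof. by rewrite /mean -mulr_suml mulrAC. Qed.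

Lemma ler_mean f g : (forall x, f x <= g x) -> mean f <= mean g.
Proof. by move=> fg; rewrite ler_wpM2r ?invr_ge0 ?ler0n// ler_sum. Qed.

Lemma mean_ge0 f : (forall x, 0 <= f x) -> 0 <= mean f.
Proof. by move=> f0; rewrite divr_ge0 ?ler0n ?sumr_ge0. Qed.

Lemma ler_norm_mean f : `|mean f| <= mean (fun x => `|f x|).
Proof.
by rewrite /mean normrM normfV normr_nat ler_wpM2r ?invr_ge0 ?ler0n ?ler_norm_sum.
Qed.

Hypothesis T_gt0 : (0 < #|T|)%N.

Lemma mean_const k : mean (fun=> k) = k.
Proof.
by rewrite /mean sumr_const -[k *+ _]mulr_natr mulfK // pnatr_eq0 -lt0n.
Qed.

Lemma mean_norm_le f k : (forall x, `|f x| <= k) -> `|mean f| <= k.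
Proof.
by move=> fk; rewrite -[leRHS]mean_const (le_trans (ler_norm_mean f)) ?ler_mean.
Qed.

(** Outer averages can be peeled off one by one without enlarging the error. *)
Lemma mean_replace f g k e :
  (forall x, `|f x - k * g x| <= e) -> `|mean f - k * mean g| <= e.
Proof. by move=> fg; rewrite -meanZ -meanB mean_norm_le. Qed.

(** Cauchy-Schwarz, as non-negativity of the variance. *)
Lemma sqr_mean_le f : mean f ^+ 2 <= mean (fun x => f x ^+ 2).
Proof.
have: 0 <= mean (fun x => (f x - mean f) ^+ 2).
  by apply: mean_ge0 => x; rewrite sqr_ge0.
rewrite (@eq_mean _ (fun x => f x ^+ 2 - (2 * mean f) * f x + mean f ^+ 2)).
  by rewrite meanD meanB meanZ mean_const; lra.
by move=> x; ring.
Qed.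

Lemma mean_norm_le_sqr f (s : R) : 0 <= s ->
  mean (fun x => f x ^+ 2) <= s ^+ 2 -> mean (fun x => `|f x|) <= s.
Proof.
move=> s0 fs; rewrite -(@ler_pXn2r _ 2) ?nnegrE ?mean_ge0//.
apply: le_trans (sqr_mean_le _) _; rewrite (@eq_mean _ (fun x => f x ^+ 2)) // => x.
by rewrite real_normK ?num_real.
Qed.

End Mean.

Notation "\mean_ x F" := (mean (fun x => F))
  (at level 41, x name, F at level 41, right associativity,
   format "\mean_ x  F").

Lemma exchange_mean (R : realFieldType) (S T : finType) (F : S -> T -> R) :
  \mean_x \mean_y F x y = \mean_y \mean_x F x y.
Proof.
by rewrite /mean -!mulr_suml exchange_big/= mulrAC.
Qed.

Section UnitInterval.
Variable R : realFieldType.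

Definition unit_fun (T : Type) (f : T -> R) := forall x, 0 <= f x <= 1.

Lemma unit_mul (a b : R) : 0 <= a <= 1 -> 0 <= b <= 1 -> 0 <= a * b <= 1.
Proof.
by move=> /andP[a0 a1] /andP[b0 b1]; rewrite mulr_ge0//= mulr_ile1.
Qed.

Lemma unit_mean (T : finType) (T_gt0 : (0 < #|T|)%N) (f : T -> R) :
  unit_fun f -> 0 <= mean f <= 1.
Proof.
move=> f01; rewrite mean_ge0/=; last by move=> x; case/andP: (f01 x).
by rewrite -[leRHS](mean_const T_gt0) ler_mean// => x; case/andP: (f01 x).
Qed.

Lemma unit_one : 0 <= (1 : R) <= 1. Proof. by rewrite ler01 lexx. Qed.

Lemma unit_sqr_sub (a b : R) : 0 <= a <= 1 -> 0 <= b <= 1 -> 0 <= (a - b) ^+ 2 <= 1.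
Proof.
by move=> /andP[a0 a1] /andP[b0 b1]; rewrite sqr_ge0/=; nra.
Qed.

End UnitInterval.

Section CutBound.
Variables (R : realFieldType) (T : finType).

(* The bilinear form is extremal at indicator functions: given [be], round [al]
   to the indicator of the rows with positive sum, then treat [be] likewise. *)
Lemma cut_bound_upper (K : T -> T -> R) (e : R) :
  (forall X Y : {set T}, \sum_(x in X) \sum_(y in Y) K x y <= e) ->
  forall al be : T -> R, unit_fun al -> unit_fun be ->
  \sum_x \sum_y al x * be y * K x y <= e.
Proof.
have round (L f : T -> R) : unit_fun f ->
    \sum_x f x * L x <= \sum_(x in [set x | 0 < L x]) L x.
  move=> f01; rewrite [leRHS]big_mkcond/=; apply: ler_sum => x _.
  rewrite inE; have /andP[f0 f1] := f01 x.
  by case: ltP => L0; [rewrite ler_piMl// ltW | rewrite mulr_ge0_le0].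
move=> Ke al be al01 be01.
pose X := [set x | 0 < \sum_y be y * K x y].
pose Y := [set y | 0 < \sum_(x in X) K x y].
apply: le_trans (Ke X Y).
apply: (@le_trans _ _ (\sum_(x in X) \sum_y be y * K x y)).
  apply: le_trans (round (fun x => \sum_y be y * K x y) al al01).
  by apply: ler_sum => x _; rewrite mulr_sumr; apply: ler_sum => y _; rewrite mulrA.
rewrite exchange_big [leRHS]exchange_big/=.
apply: le_trans (round (fun y => \sum_(x in X) K x y) be be01).
by apply: ler_sum => y _; rewrite mulr_sumr.
Qed.

Lemma cut_bound (K : T -> T -> R) (e : R) :
  (forall X Y : {set T}, `|\sum_(x in X) \sum_(y in Y) K x y| <= e) ->
  forall al be : T -> R, unit_fun al -> unit_fun be ->
  `|\sum_x \sum_y al x * be y * K x y| <= e.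
Proof.
move=> Ke al be al01 be01; rewrite ler_norml; apply/andP; split; last first.
  by apply: cut_bound_upper => // X Y; case/(elimT (ler_normlP _ _)): (Ke X Y).
rewrite lerNl -sumrN.
under eq_bigr do rewrite -sumrN; under eq_bigr do under eq_bigr do rewrite -mulrN.
apply: cut_bound_upper al01 be01 => X Y.
under eq_bigr do rewrite sumrN; rewrite sumrN.
by case/(elimT (ler_normlP _ _)): (Ke X Y).
Qed.

End CutBound.

(** * From constant [W d] to constant [W] *)

Section Core.
Variables (R : realFieldType) (T : finType) (T_gt0 : (0 < #|T|)%N).
Variables (W : T -> T -> R) (c e : R).
Hypothesis W_sym : forall x y, W x y = W y x.
Hypothesis W01 : forall x y, 0 <= W x y <= 1.
Hypothesis c01 : 0 < c <= 1.

Definition degree x : R := \mean_y W x y.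
Definition codegree x y : R := \mean_z W x z * W z y.
Local Notation deg := degree.
Local Notation d := codegree.

(** Weights in the unit interval, rather than sets, allow values of [W], [deg] and [d] with one
    argument fixed to be absorbed into [al] and [be]. *)
Hypothesis W_codegree : forall al be : T -> R, unit_fun al -> unit_fun be ->
  `|\mean_x \mean_y al x * be y * (W x y * d x y - c)| <= e.

Lemma degree01 x : 0 <= deg x <= 1.
Proof. exact: unit_mean. Qed.

Lemma codegree01 x y : 0 <= d x y <= 1.
Proof. by apply: unit_mean => // z; apply: unit_mul. Qed.

Lemma W_ge0 x y : 0 <= W x y. Proof. by case/andP: (W01 x y). Qed.
Lemma W_le1 x y : W x y <= 1. Proof. by case/andP: (W01 x y). Qed.
Lemma d_le1 x y : d x y <= 1. Proof. by case/andP: (codegree01 x y). Qed.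

Lemma e_ge0 : 0 <= e.
Proof.
by apply: le_trans (W_codegree (fun _ => unit_one R) (fun _ => unit_one R)).
Qed.

(* [d] is an average of products of a function of [x] and a function of [y], so
   its powers are admissible weights for the cut bound. *)
Lemma W_codegree_pow k (al be : T -> R) : unit_fun al -> unit_fun be ->
  `|\mean_x \mean_y al x * be y * d x y ^+ k * (W x y * d x y - c)| <= e.
Proof.
elim: k al be => [|k IH] al be al01 be01.
  rewrite (_ : mean _ = \mean_x \mean_y al x * be y * (W x y * d x y - c)).
    exact: W_codegree.
  by apply: eq_mean => x; apply: eq_mean => y; rewrite expr0 mulr1.
rewrite (_ : mean _ = \mean_z \mean_x \mean_y
    (al x * W x z) * (be y * W z y) * d x y ^+ k * (W x y * d x y - c)).
  by apply: mean_norm_le => // z; apply: IH => ?; apply: unit_mul.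
rewrite [RHS]exchange_mean; apply: eq_mean => x.
rewrite [RHS]exchange_mean; apply: eq_mean => y.
rewrite exprS {1}/codegree.
transitivity ((\mean_z W x z * W z y) *
   (al x * be y * d x y ^+ k * (W x y * d x y - c))); first by ring.
by rewrite -meanZr; apply: eq_mean => z; ring.
Qed.

(** The working form: under an admissible weight, [W x y * d x y] may be exchanged for [c] at cost
    [e]. *)
Lemma W_codegree_replace k (al be : T -> R) : unit_fun al -> unit_fun be ->
  `|\mean_x \mean_y al x * be y * d x y ^+ k * (W x y * d x y)
    - c * \mean_x \mean_y al x * be y * d x y ^+ k| <= e.
Proof.
move=> al01 be01; rewrite -meanZ -meanB.
rewrite (_ : mean _ = \mean_x \mean_y
    al x * be y * d x y ^+ k * (W x y * d x y - c)); first exact: W_codegree_pow.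
apply: eq_mean => x; rewrite -meanZ -meanB; apply: eq_mean => y; ring.
Qed.

(* [M1] and [M2] are the defects in Cauchy-Schwarz and in
   [deg x * deg y <= (deg x ^ 2 + deg y ^ 2) / 2]. Substituting [c] for [W d] twice
   turns [A] into [c^2 P] and [B] into [c^2 S], so [M1 + c^2 M2] is small. *)
Let wt x y z z' := W x y * W x z * W x z' * W z y * W z' y.

Let M1 := \mean_x \mean_y \mean_z \mean_z' wt x y z z' * (d z y - d z' y) ^+ 2.
Let M2 := \mean_x \mean_y W x y * (deg x - deg y) ^+ 2.
Let A := \mean_x \mean_y \mean_z \mean_z' wt x y z z' * d z y ^+ 2.
Let B := \mean_x \mean_y \mean_z \mean_z' wt x y z z' * (d z y * d z' y).
Let P := \mean_x \mean_y W x y * deg x * deg y.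
Let S := \mean_x deg x ^+ 3.

Lemma M1E : M1 = 2 * A - 2 * B.
Proof.
(* [wt] is symmetric in [z] and [z'], so both squares in [M1] average to [A]. *)
have AE : A = \mean_x \mean_y \mean_z \mean_z' wt x y z z' * d z' y ^+ 2.
  apply: eq_mean => x; apply: eq_mean => y; rewrite exchange_mean.
  by apply: eq_mean => z; apply: eq_mean => z'; rewrite /wt; ring.
transitivity (A + A - 2 * B); last by ring.
rewrite {2}AE -!meanZ -meanD -meanB; apply: eq_mean => x.
rewrite -!meanZ -meanD -meanB; apply: eq_mean => y.
rewrite -!meanZ -meanD -meanB; apply: eq_mean => z.
rewrite -!meanZ -meanD -meanB; apply: eq_mean => z'.
ring.
Qed.

Lemma M2E : M2 = 2 * S - 2 * P.
Proof.
have S1 : S = \mean_x \mean_y W x y * deg x ^+ 2.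
  by apply: eq_mean => x; rewrite meanZr exprS.
have S2 : S = \mean_x \mean_y W x y * deg y ^+ 2.
  rewrite exchange_mean S1; apply: eq_mean => x; apply: eq_mean => y.
  by rewrite W_sym.
transitivity (S + S - 2 * P); last by ring.
rewrite {1}S1 S2 -!meanZ -meanD -meanB; apply: eq_mean => x.
rewrite -!meanZ -meanD -meanB; apply: eq_mean => y; ring.
Qed.

(** Both sides are the density of the path with three edges, once centred at the middle edge and
    once read from an end. *)
Lemma PE : P = \mean_z \mean_x \mean_y W x z * d z y.
Proof.
rewrite exchange_mean.
transitivity (\mean_x \mean_z W x z * \mean_w W z w * deg w); last first.
  apply: eq_mean => x; apply: eq_mean => z; rewrite meanZ; congr (_ * _).
  rewrite exchange_mean; apply: eq_mean => w; rewrite meanZ; congr (_ * _).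
rewrite exchange_mean; apply: eq_mean => z.
rewrite (meanZr _ (fun x => W x z)) (_ : (\mean_x W x z) = deg z).
  by rewrite -meanZ; apply: eq_mean => w; ring.
by apply: eq_mean => x; rewrite W_sym.
Qed.

Lemma A_approx : `|A - c ^+ 2 * P| <= 2 * e.
Proof.
pose A1 := \mean_x \mean_z' \mean_z \mean_y
   W x z * (W x z' * W x y * W z' y) * d z y ^+ 1.
have AA1 : `|A - c * A1| <= e.
  rewrite (_ : A = \mean_x \mean_z' \mean_z \mean_y
     W x z * (W x z' * W x y * W z' y) * d z y ^+ 1 * (W z y * d z y)).
    apply: mean_replace => // x; apply: mean_replace => // z'.
    apply: W_codegree_replace => // y; do !apply: unit_mul => //.
  apply: eq_mean => x; rewrite exchange_mean.
  rewrite [RHS]exchange_mean; apply: eq_mean => z.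
  rewrite exchange_mean; apply: eq_mean => z'; apply: eq_mean => y.
  by rewrite /wt; ring.
(* After the replacement at [(z, y)], averaging over [z'] produces [d x y]. With [z] held fixed,
   [W x y * d x y] is then replaced under the weight [W x z * d z y]. *)
have A1P : `|A1 - c * P| <= e.
  rewrite (_ : A1 = \mean_z \mean_x \mean_y
     W x z * d z y * d x y ^+ 0 * (W x y * d x y)).
    rewrite PE; apply: mean_replace => // z.
    rewrite (_ : (\mean_x \mean_y W x z * d z y) =
       \mean_x \mean_y W x z * d z y * d x y ^+ 0).
      by apply: W_codegree_replace => // y; exact: codegree01.
    by apply: eq_mean => x; apply: eq_mean => y; rewrite mulr1.
  rewrite [RHS]exchange_mean; apply: eq_mean => x.
  rewrite exchange_mean; apply: eq_mean => z.
  rewrite exchange_mean; apply: eq_mean => y.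
  rewrite expr0 mulr1 mulrA -meanZ; apply: eq_mean => z'; ring.
have /andP[c0 c1] := c01; move: AA1 A1P e_ge0.
rewrite !ler_norml => /andP[? ?] /andP[? ?] ?; apply/andP; split; nra.
Qed.

(** [W z y * d z y] is replaced with [x], [z'] fixed, then [W z' y * d z' y] with [x], [z] fixed;
    the remaining three factors average to [deg x ^+ 3]. *)
Lemma B_approx : `|B - c ^+ 2 * S| <= 2 * e.
Proof.
pose B1 := \mean_x \mean_z \mean_z' \mean_y
   W x z' * (W x y * W x z) * d z' y ^+ 0 * (W z' y * d z' y).
have BB1 : `|B - c * B1| <= e.
  have -> : B1 = \mean_x \mean_z' \mean_z \mean_y
     W x z * (W x z' * W x y * W z' y * d z' y) * d z y ^+ 0.
    apply: eq_mean => x; rewrite exchange_mean; apply: eq_mean => z'.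
    apply: eq_mean => z; apply: eq_mean => y; ring.
  rewrite (_ : B = \mean_x \mean_z' \mean_z \mean_y
     W x z * (W x z' * W x y * W z' y * d z' y) * d z y ^+ 0 * (W z y * d z y)).
    apply: mean_replace => // x; apply: mean_replace => // z'.
    apply: W_codegree_replace => // y.
    by apply: unit_mul; [do !apply: unit_mul | exact: codegree01].
  apply: eq_mean => x; rewrite exchange_mean.
  rewrite [RHS]exchange_mean; apply: eq_mean => z.
  rewrite exchange_mean; apply: eq_mean => z'; apply: eq_mean => y.
  by rewrite /wt; ring.
have B1S : `|B1 - c * S| <= e.
  have -> : S = \mean_x \mean_z \mean_z' \mean_y
     W x z' * (W x y * W x z) * d z' y ^+ 0.
    apply: eq_mean => x; rewrite !exprS expr0 mulr1 -meanZr; apply: eq_mean => z.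
    rewrite -meanZr -meanZ; apply: eq_mean => z'.
    rewrite -meanZ -meanZ; apply: eq_mean => y; ring.
  apply: mean_replace => // x; apply: mean_replace => // z.
  by apply: W_codegree_replace => // y; apply: unit_mul.
have /andP[c0 c1] := c01; move: BB1 B1S e_ge0.
rewrite !ler_norml => /andP[? ?] /andP[? ?] ?; apply/andP; split; nra.
Qed.

Lemma M1_ge0 : 0 <= M1.
Proof.
do 4!(apply: mean_ge0 => ?).
by rewrite mulr_ge0 ?sqr_ge0// !mulr_ge0 ?W_ge0.
Qed.

Lemma M2_ge0 : 0 <= M2.
Proof. by do 2!(apply: mean_ge0 => ?); rewrite mulr_ge0 ?sqr_ge0 ?W_ge0. Qed.

(** The left side is [2 * (A - c ^+ 2 * P) - 2 * (B - c ^+ 2 * S)]. *)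
Lemma M1_M2_le : M1 + c ^+ 2 * M2 <= 8 * e.
Proof.
rewrite M1E M2E; move: A_approx B_approx; rewrite !ler_norml.
by move=> /andP[? ?] /andP[? ?]; lra.
Qed.

(** The weight [W] in [M2] is removed: it dominates [W * d] because [d <= 1], and once the square is
    expanded into product weights, [W * d] is exchanged for [c]. *)
Lemma degree_spread : c ^+ 3 * (\mean_x \mean_y (deg x - deg y) ^+ 2) <= 12 * e.
Proof.
set V := \mean_x _.
pose G (f g : T -> R) := \mean_x \mean_y f x * g y * d x y ^+ 0 * (W x y * d x y).
pose H (f g : T -> R) := \mean_x \mean_y f x * g y * d x y ^+ 0.
have VE : V = H (fun x => deg x ^+ 2) (fun=> 1) + H (fun=> 1) (fun x => deg x ^+ 2)
              - 2 * H deg deg.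
  rewrite -meanZ -meanD -meanB; apply: eq_mean => x.
  rewrite -meanZ -meanD -meanB; apply: eq_mean => y; ring.
have WE : G (fun x => deg x ^+ 2) (fun=> 1) + G (fun=> 1) (fun x => deg x ^+ 2)
              - 2 * G deg deg <= M2.
  rewrite -meanZ -meanD -meanB; apply: ler_mean => x.
  rewrite -meanZ -meanD -meanB; apply: ler_mean => y.
  rewrite [leLHS](_ : _ = W x y * (deg x - deg y) ^+ 2 * d x y); last by ring.
  by rewrite ler_piMr ?d_le1// mulr_ge0 ?W_ge0 ?sqr_ge0.
have u1 : unit_fun (fun _ : T => 1 : R) by move=> _; exact: unit_one.
have u2 : unit_fun (fun x => deg x ^+ 2).
  by move=> x; rewrite expr2; apply: unit_mul; exact: degree01.
move: (W_codegree_replace 0 u2 u1) (W_codegree_replace 0 u1 u2).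
move: (W_codegree_replace 0 degree01 degree01) M1_M2_le M1_ge0 M2_ge0 e_ge0.
rewrite -!/(G _ _) -!/(H _ _) !ler_norml => /andP[? ?] ? ? ? ? /andP[? ?] /andP[? ?].
(* One [e] for each square, two for the cross term. *)
have cV : c * V <= M2 + 4 * e by rewrite VE; lra.
have /andP[c0 c1] := c01.
have : c ^+ 2 * (c * V) <= c ^+ 2 * (M2 + 4 * e) by rewrite ler_pM2l// exprn_gt0.
have : c ^+ 2 * (4 * e) <= 4 * e by rewrite ler_piMl ?mulr_ge0// exprn_ile1// ltW.
lra.
Qed.

Lemma mean_lower (S' : finType) (F G : S' -> R) (k b : R) : (0 < #|S'|)%N ->
  (forall r, k * G r - b <= F r) -> k * mean G - b <= mean F.
Proof.
move=> S'0 FG; rewrite -meanZ -[in leLHS](mean_const S'0 b) -meanB.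
exact: ler_mean.
Qed.

(** Strips a factor [W] from a non-negative average: [W] dominates [W * d], which is exchanged for
    [c]. *)
Lemma W_lower (al be : T -> R) : unit_fun al -> unit_fun be ->
  c * (\mean_x \mean_y al x * be y) - e <= \mean_x \mean_y al x * be y * W x y.
Proof.
move=> al01 be01; have := W_codegree_replace 0 al01 be01.
rewrite ler_norml => /andP[+ _].
have -> : (\mean_x \mean_y al x * be y * d x y ^+ 0) = \mean_x \mean_y al x * be y.
  by apply: eq_mean => x; apply: eq_mean => y; rewrite mulr1.
set U := mean _ => H; suff : U <= \mean_x \mean_y al x * be y * W x y by lra.
apply: ler_mean => x; apply: ler_mean => y; rewrite mulr1 mulrA.
by rewrite ler_piMr ?d_le1// !mulr_ge0 ?W_ge0//; [case/andP: (al01 x)|case/andP: (be01 y)].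
Qed.

(** Here the weight itself involves [d x y]. Expanding the square leaves powers of [d], which are
    admissible, at cost [1 + 2 + 1] times [e]. *)
Lemma W_lower_codegree (g v : T -> R) : unit_fun g -> unit_fun v ->
  c * (\mean_x \mean_y g y * (d x y - v y) ^+ 2) - 4 * e
    <= \mean_x \mean_y g y * (d x y - v y) ^+ 2 * W x y.
Proof.
move=> g01 v01.
pose G k (f : T -> R) := \mean_x \mean_y 1 * f y * d x y ^+ k * (W x y * d x y).
pose H k (f : T -> R) := \mean_x \mean_y 1 * f y * d x y ^+ k.
have HE : (\mean_x \mean_y g y * (d x y - v y) ^+ 2) =
    H 2%N g + H 0%N (fun y => g y * v y ^+ 2) - 2 * H 1%N (fun y => g y * v y).
  rewrite -meanZ -meanD -meanB; apply: eq_mean => x.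
  rewrite -meanZ -meanD -meanB; apply: eq_mean => y; ring.
have GE : G 2%N g + G 0%N (fun y => g y * v y ^+ 2) - 2 * G 1%N (fun y => g y * v y)
    <= \mean_x \mean_y g y * (d x y - v y) ^+ 2 * W x y.
  rewrite -meanZ -meanD -meanB; apply: ler_mean => x.
  rewrite -meanZ -meanD -meanB; apply: ler_mean => y.
  rewrite [leLHS](_ : _ = g y * (d x y - v y) ^+ 2 * W x y * d x y); last by ring.
  rewrite ler_piMr ?d_le1// mulr_ge0 ?W_ge0// mulr_ge0 ?sqr_ge0//.
  by case/andP: (g01 y).
have u1 : unit_fun (fun _ : T => 1 : R) by move=> _; exact: unit_one.
have gv : unit_fun (fun y => g y * v y) by move=> ?;  exact: unit_mul.
have gvv : unit_fun (fun y => g y * v y ^+ 2).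
  by move=> ?; rewrite expr2 mulrA; exact: unit_mul.
move: (W_codegree_replace 2 u1 g01) (W_codegree_replace 1 u1 gv).
move: (W_codegree_replace 0 u1 gvv).
rewrite -!/(G _ _) -!/(H _ _) !ler_norml => /andP[? ?] /andP[? ?] /andP[? ?].
rewrite HE; apply: le_trans GE; lra.
Qed.

(** The five factors of [wt] are stripped from [M1] in turn. The three containing [x] cost [e] each;
    the last two, whose pair also occurs in the square, cost [4 * e] each. With [M1 <= 8 * e] the
    total is [19 * e]. *)
Lemma codegree_spread :
  c ^+ 5 * (\mean_y \mean_z \mean_z' (d z y - d z' y) ^+ 2) <= 19 * e.
Proof.
pose q y z z' := (d z y - d z' y) ^+ 2.
have q01 y z z' : 0 <= q y z z' <= 1.
  by apply: unit_sqr_sub; exact: codegree01.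
have Wq y z z' : 0 <= W z y * W z' y * q y z z' <= 1.
  by apply: unit_mul => //; exact: unit_mul.
pose N1 := \mean_y \mean_z' \mean_x \mean_z
  (W x y * W x z') * (W z y * W z' y * q y z z').
pose N2 := \mean_y \mean_z \mean_x \mean_z' W x y * (W z y * W z' y * q y z z').
pose N3 := \mean_z \mean_z' mean (fun _ : T => \mean_y 1 * (W z y * W z' y * q y z z')).
pose N4 := \mean_z' \mean_z \mean_y W z' y * q y z z'.
pose N5 := \mean_z \mean_z' \mean_y 1 * (d z' y - d z y) ^+ 2.
have M1N1 : c * N1 - e <= M1.
  rewrite (_ : M1 = \mean_y \mean_z' \mean_x \mean_z
      (W x y * W x z') * (W z y * W z' y * q y z z') * W x z).
    apply: mean_lower => // y; apply: mean_lower => // z'.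
    by apply: W_lower => // x; exact: unit_mul.
  rewrite [M1]exchange_mean; apply: eq_mean => y.
  rewrite [RHS]exchange_mean; apply: eq_mean => x.
  rewrite exchange_mean; apply: eq_mean => z'; apply: eq_mean => z.
  by rewrite /wt /q; ring.
have N1N2 : c * N2 - e <= N1.
  rewrite (_ : N1 = \mean_y \mean_z \mean_x \mean_z'
      W x y * (W z y * W z' y * q y z z') * W x z').
    apply: mean_lower => // y; apply: mean_lower => // z.
    by apply: W_lower.
  apply: eq_mean => y; rewrite exchange_mean.
  rewrite [RHS]exchange_mean; apply: eq_mean => x.
  rewrite exchange_mean; apply: eq_mean => z; apply: eq_mean => z'.
  by ring.
have u1 : unit_fun (fun _ : T => 1 : R) by move=> _; exact: unit_one.
have N2N3 : c * N3 - e <= N2.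
  rewrite (_ : N2 = \mean_z \mean_z' \mean_x \mean_y
      1 * (W z y * W z' y * q y z z') * W x y).
    apply: mean_lower => // z; apply: mean_lower => // z'.
    by apply: W_lower.
  rewrite [LHS]exchange_mean; apply: eq_mean => z.
  rewrite [RHS]exchange_mean [LHS]exchange_mean; apply: eq_mean => x.
  rewrite exchange_mean; apply: eq_mean => z'; apply: eq_mean => y.
  by ring.
have N3N4 : c * N4 - 4 * e <= N3.
  rewrite (_ : N3 = \mean_z' \mean_z \mean_y W z' y * q y z z' * W z y).
    apply: mean_lower => // z'.
    apply: W_lower_codegree => // y; exact: codegree01.
  rewrite [LHS]exchange_mean; apply: eq_mean => z'; apply: eq_mean => z.
  rewrite mean_const//; apply: eq_mean => y; ring.
have N4N5 : c * N5 - 4 * e <= N4.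
  rewrite (_ : N4 = \mean_z \mean_z' \mean_y 1 * (d z' y - d z y) ^+ 2 * W z' y).
    apply: mean_lower => // z.
    apply: W_lower_codegree => // y; exact: codegree01.
  rewrite [LHS]exchange_mean; apply: eq_mean => z; apply: eq_mean => z'.
  by apply: eq_mean => y; rewrite /q; ring.
have -> : (\mean_y \mean_z \mean_z' (d z y - d z' y) ^+ 2) = N5.
  rewrite exchange_mean; apply: eq_mean => z; rewrite exchange_mean.
  by apply: eq_mean => z'; apply: eq_mean => y; ring.
have M1e : M1 <= 8 * e.
  have /andP[c0 _] := c01; have := M1_M2_le.
  have : 0 <= c ^+ 2 * M2 by rewrite mulr_ge0 ?exprn_ge0 ?M2_ge0// ltW.
  lra.
have /andP[c0 c1] := c01; have e0 := e_ge0.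
(* Since [c <= 1], multiplying by [c ^+ k] does not enlarge the error, so the five bounds chain. *)
have step k (a b f : R) : 0 <= f -> c * b - f <= a -> c ^+ k.+1 * b - f <= c ^+ k * a.
  move=> f0 ab; have ck0 : 0 <= c ^+ k by rewrite exprn_ge0// ltW.
  have ck1 : c ^+ k <= 1 by rewrite exprn_ile1// ltW.
  have := ler_wpM2l ck0 ab; have := ler_piMl f0 ck1.
  rewrite mulrBr exprSr -mulrA; lra.
have e4 : 0 <= 4 * e by rewrite mulr_ge0.
move: (step 0%N _ _ _ e0 M1N1) (step 1%N _ _ _ e0 N1N2) (step 2%N _ _ _ e0 N2N3).
move: (step 3%N _ _ _ e4 N3N4) (step 4%N _ _ _ e4 N4N5).
rewrite expr0 mul1r; lra.
Qed.

(** * Concentration of degrees and codegrees, and quasirandomness *)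

Variables p s : R.
Hypothesis p01 : 0 < p <= 1.
Hypothesis cE : c = p ^+ 3.
Hypothesis s01 : 0 < s <= 1.
(** Turns [codegree_spread] into a mean-square bound [s ^+ 2]. As [12 <= 19] and [c ^+ 5 <= c ^+ 3],
    it does the same for [degree_spread]. *)
Hypothesis es : 19 * e <= c ^+ 5 * s ^+ 2.

Let a := mean deg.

Lemma degree_concentrated : \mean_x `|deg x - a| <= s.
Proof.
have /andP[s0 s1] := s01; have /andP[c0 c1] := c01; have e0 := e_ge0.
apply: mean_norm_le_sqr => //; first exact: ltW.
apply: (@le_trans _ _ (\mean_x \mean_y (deg x - deg y) ^+ 2)).
  apply: ler_mean => x; rewrite -{1}(mean_const T_gt0 (deg x)) -meanB.
  exact: sqr_mean_le.
have := degree_spread; set V := mean _ => VL.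
have c3 : 0 < c ^+ 3 by rewrite exprn_gt0.
rewrite -(ler_pM2l c3); apply: le_trans VL _.
apply: (@le_trans _ _ (19 * e)); first lra.
apply: le_trans es _; rewrite ler_wpM2r ?sqr_ge0//.
by rewrite ler_wiXn2l// ltW.
Qed.

(** [d z y] is within [s] of its average [D y] over [z], by Cauchy-Schwarz. As [D y] averages
    [W y w * deg w], degree concentration puts it within [2 * s] of [a ^+ 2]. *)
Lemma codegree_concentrated : \mean_y \mean_z `|d z y - a ^+ 2| <= 3 * s.
Proof.
have /andP[s0 s1] := s01; have /andP[c0 c1] := c01; have e0 := e_ge0.
pose D y := \mean_z d z y.
have dD : \mean_y \mean_z `|d z y - D y| <= s.
  apply: le_trans (_ : \mean_y `|\mean_z `|d z y - D y| | <= s).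
    by apply: ler_mean => y; exact: ler_norm.
  apply: mean_norm_le_sqr => //; first exact: ltW.
  apply: (@le_trans _ _ (\mean_y \mean_z \mean_z' (d z y - d z' y) ^+ 2)); last first.
    have c5 : 0 < c ^+ 5 by rewrite exprn_gt0.
    by rewrite -(ler_pM2l c5); apply: le_trans codegree_spread es.
  apply: ler_mean => y; apply: le_trans (sqr_mean_le T_gt0 _) _.
  apply: ler_mean => z; rewrite real_normK ?num_real//.
  rewrite -{1}(mean_const T_gt0 (d z y)) -meanB.
  exact: sqr_mean_le.
have DE y : D y - a ^+ 2 = (\mean_w W y w * (deg w - a)) + a * (deg y - a).
  have -> : D y = \mean_w W y w * deg w.
    rewrite /D exchange_mean; apply: eq_mean => w.
    rewrite -meanZ; apply: eq_mean => z.
    by rewrite mulrC [W y w]W_sym [W z w]W_sym.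
  have -> : (\mean_w W y w * (deg w - a)) = (\mean_w W y w * deg w) - deg y * a.
    by rewrite -meanZr -meanB; apply: eq_mean => w; ring.
  ring.
have a01 : 0 <= a <= 1 by apply: unit_mean => // x; exact: degree01.
have Da : \mean_y `|D y - a ^+ 2| <= 2 * s.
  apply: (@le_trans _ _ (\mean_y ((\mean_w `|deg w - a|) + `|deg y - a|))).
    apply: ler_mean => y; rewrite DE; apply: le_trans (ler_normD _ _) _.
    apply: lerD.
      apply: le_trans (ler_norm_mean _) _; apply: ler_mean => w.
      by rewrite normrM ger0_norm ?W_ge0// ler_piMl ?W_le1.
    by rewrite normrM ger0_norm ?ler_piMl//; case/andP: a01.
  rewrite meanD mean_const//; have := degree_concentrated; lra.
apply: (@le_trans _ _ ((\mean_y \mean_z `|d z y - D y|) + \mean_y `|D y - a ^+ 2|));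
  last lra.
rewrite -meanD; apply: ler_mean => y.
rewrite -[X in _ + X](mean_const T_gt0) -meanD; apply: ler_mean => z.
by apply: le_trans (ler_normD _ _); rewrite addrA subrK.
Qed.

(** The mean of [W * d] is within [e <= s] of [p ^+ 3] and within [3 * s] of [a ^+ 3]; the cofactor
    of [p - a] in [p ^+ 3 - a ^+ 3] is at least [p ^+ 2]. *)
Lemma density_close : `|a - p| <= 4 * s / p ^+ 2.
Proof.
have /andP[s0 s1] := s01; have /andP[c0 c1] := c01; have e0 := e_ge0.
have /andP[p0 p1] := p01.
have a01 : 0 <= a <= 1 by apply: unit_mean => // x; exact: degree01.
have /andP[a0 a1] := a01.
have u1 : unit_fun (fun _ : T => 1 : R) by move=> _; exact: unit_one.
have es' : e <= s.
  have : c ^+ 5 * s ^+ 2 <= s.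
    by rewrite expr2 mulrA ger_pMl// mulr_ile1 ?exprn_ge0 ?(ltW c0) ?(ltW s0) ?exprn_ile1 ?(ltW c0).
  move=> h; have := es; lra.
have ca : `|c - a ^+ 3| <= 4 * s.
  pose Wd := \mean_y \mean_z W z y * d z y.
  have Wdc : `|Wd - c| <= e.
    have := W_codegree u1 u1; congr (`|_| <= _); rewrite exchange_mean.
    rewrite -[in RHS](mean_const T_gt0 c) -meanB; apply: eq_mean => y.
    rewrite -[in RHS](mean_const T_gt0 c) -meanB; apply: eq_mean => z.
    by rewrite !mul1r.
  have Wda : `|Wd - a ^+ 3| <= 3 * s.
    have -> : Wd - a ^+ 3 = \mean_y \mean_z W z y * (d z y - a ^+ 2).
      have -> : a ^+ 3 = \mean_y \mean_z W z y * a ^+ 2.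
        rewrite exprS {1}/a -meanZr; apply: eq_mean => y.
        by rewrite -meanZr; apply: eq_mean => z; rewrite W_sym.
      rewrite -meanB; apply: eq_mean => y.
      by rewrite -meanB; apply: eq_mean => z; ring.
    apply: le_trans codegree_concentrated.
    apply: le_trans (ler_norm_mean _) _; apply: ler_mean => y.
    apply: le_trans (ler_norm_mean _) _; apply: ler_mean => z.
    by rewrite normrM ger0_norm ?W_ge0// ler_piMl ?W_le1.
  move: Wdc Wda; rewrite !ler_norml => /andP[? ?] /andP[? ?].
  by apply/andP; split; lra.
have p2 : 0 < p ^+ 2 by rewrite exprn_gt0.
rewrite ler_pdivlMr//; apply: le_trans ca.
have -> : c - a ^+ 3 = (p - a) * (p ^+ 2 + (p * a + a ^+ 2)) by rewrite cE; ring.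
rewrite normrM distrC ler_wpM2l//; apply: le_trans (ler_norm _).
rewrite lerDl addr_ge0 ?sqr_ge0// mulr_ge0//; exact: ltW.
Qed.

(** Cauchy-Schwarz in [y] removes [be]. Expanding the square and averaging over [y] leaves only
    deviations of codegrees ([3 * s]) and of degrees ([s], twice). *)
Lemma cut_norm_close (al be : T -> R) : unit_fun al -> unit_fun be ->
  (\mean_y be y * \mean_x al x * (W x y - a)) ^+ 2 <= 5 * s.
Proof.
move=> al01 be01.
have a01 : 0 <= a <= 1 by apply: unit_mean => // x; exact: degree01.
have /andP[a0 a1] := a01.
have absle (f : T -> R) (t : R) x : unit_fun f -> `|f x * t| <= `|t|.
  by move=> f01; have /andP[f0 f1] := f01 x; rewrite normrM ger0_norm// ler_piMl.
apply: le_trans (sqr_mean_le T_gt0 _) _.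
apply: (@le_trans _ _ (\mean_y (\mean_x al x * (W x y - a)) ^+ 2)).
  apply: ler_mean => y; rewrite -real_normK ?num_real//.
  rewrite -[leRHS]real_normK ?num_real// ler_sqr ?nnegrE//.
  exact: absle.
have -> : (\mean_y (\mean_x al x * (W x y - a)) ^+ 2) =
   \mean_x \mean_z al z * (al x * (d z x - a ^+ 2
      - a * (deg x - a) - a * (deg z - a))).
  transitivity (\mean_y \mean_x \mean_z (al x * (W x y - a)) * (al z * (W z y - a))).
    apply: eq_mean => y; rewrite expr2 -meanZr; apply: eq_mean => x.
    by rewrite -meanZ.
  rewrite exchange_mean; apply: eq_mean => x; rewrite exchange_mean.
  apply: eq_mean => z.
  transitivity (al z * al x * \mean_y (W z y * W y x - a * W x y - a * W z y + a ^+ 2)).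
    by rewrite -meanZ; apply: eq_mean => y; rewrite [W y x]W_sym; ring.
  rewrite meanD mean_const// !meanB !meanZ.
  rewrite -/(codegree z x) -/(degree x) -/(degree z); ring.
apply: (@le_trans _ _ (\mean_x \mean_z
   (`|d z x - a ^+ 2| + `|deg x - a| + `|deg z - a|))).
  apply: ler_mean => x; apply: ler_mean => z; apply: le_trans (ler_norm _) _.
  apply: le_trans (absle _ _ _ al01) _; apply: le_trans (absle _ _ _ al01) _.
  apply: le_trans (ler_normB _ _) _; apply: lerD.
    apply: le_trans (ler_normB _ _) _; apply: lerD => //.
    by rewrite normrM ger0_norm// ler_piMl.
  by rewrite normrM ger0_norm// ler_piMl.
have -> : (\mean_x \mean_z (`|d z x - a ^+ 2| + `|deg x - a| + `|deg z - a|)) =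
  (\mean_x \mean_z `|d z x - a ^+ 2|) + (\mean_x `|deg x - a|) + (\mean_x `|deg x - a|).
  rewrite -meanD -[X in _ + X](mean_const T_gt0) -meanD; apply: eq_mean => x.
  by rewrite !meanD mean_const.
have := codegree_concentrated; have := degree_concentrated; lra.
Qed.

(** Passing from [p] to [a] costs at most [4 * s / p ^+ 2], the cut norm around [a] at most the root
    of [5 * s]; the two conditions on [s] make each at most [eps / 2]. *)
Lemma W_quasirandom (eps : R) (al be : T -> R) : unit_fun al -> unit_fun be ->
  20 * s <= eps ^+ 2 -> 8 * s <= eps * p ^+ 2 -> 0 < eps ->
  `|\mean_y be y * \mean_x al x * (W x y - p)| <= eps.
Proof.
move=> al01 be01 se1 se2 eps0; have /andP[p0 p1] := p01.
have -> : (\mean_y be y * \mean_x al x * (W x y - p)) =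
  (\mean_y be y * \mean_x al x * (W x y - a)) + (\mean_y be y * \mean_x al x) * (a - p).
  rewrite -meanZr -meanD; apply: eq_mean => y; rewrite -mulrA -mulrDr; congr (_ * _).
  by rewrite -meanZr -meanD; apply: eq_mean => x; ring.
apply: le_trans (ler_normD _ _) _.
have p2 : 0 < p ^+ 2 by rewrite exprn_gt0.
have h1 : `|\mean_y be y * \mean_x al x * (W x y - a)| <= eps / 2.
  rewrite -ler_sqr ?nnegrE//; last by lra.
  rewrite real_normK ?num_real//; apply: le_trans (cut_norm_close al01 be01) _.
  rewrite expr_div_n; lra.
have h2 : `|(\mean_y be y * \mean_x al x) * (a - p)| <= eps / 2.
  rewrite normrM.
  have /andP[u0 u1] : 0 <= (\mean_y be y * \mean_x al x) <= 1.
    by apply: unit_mean => // y; apply: unit_mul => //; exact: unit_mean.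
  rewrite ger0_norm//; apply: le_trans (ler_piMl _ u1) _ => //.
  apply: le_trans density_close _; rewrite ler_pdivrMr//; lra.
lra.
Qed.

End Core.

(** * Transfer between the graph and its blow-up *)

Section Transfer.
Variables (R : realType) (G : sgraph).
Local Notation n := (#|G|%:R : R).
Let W (x y : G) : R := (adj x y)%:R.

Lemma vertex_neq0 : n != 0.
Proof. by rewrite pnatr_eq0 -lt0n vertex_gt0. Qed.

Lemma codegree_common x y : codegree W x y = #|common x y|%:R / n.
Proof.
rewrite /codegree /mean card_set_sum natr_sum; congr (_ / _).
by apply: eq_bigr => z _; rewrite -natrM mulnb.
Qed.

Lemma sum_common (X Y : {set G}) :
  (\sum_(x in X) \sum_(y in Y) adj x y * #|common x y|)%N%:R =
  n * \sum_(x in X) \sum_(y in Y) W x y * codegree W x y.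
Proof.
rewrite natr_sum mulr_sumr; apply: eq_bigr => x _.
rewrite natr_sum mulr_sumr; apply: eq_bigr => y _.
by rewrite codegree_common natrM [RHS]mulrCA [n * _]mulrC divfK ?vertex_neq0.
Qed.

Lemma W_sym x y : W x y = W y x.
Proof. by rewrite /W adj_sym. Qed.

Lemma W01 x y : 0 <= W x y <= 1.
Proof. by rewrite ler0n lern1 leq_b1. Qed.

Lemma e_between_sum (X Y : {set G}) :
  (e_between X Y)%:R = \sum_(x in X) \sum_(y in Y) W x y :> R.
Proof.
rewrite /e_between card_set_sum natr_sum.
rewrite (eq_bigr (fun x => \sum_(y in Y) (adj x y : nat)%:R))//.
rewrite pair_big_dep/= [RHS]big_mkcond/=; apply: eq_bigr => -[x y] _ /=.
by case: (x \in X); case: (y \in Y).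
Qed.

Lemma hom_density_K3 :
  hom_density R K3 G = \mean_x \mean_y W x y * codegree W x y.
Proof.
have := sum_common setT setT.
rewrite /hom_density nb_hom_K3 card_ord.
under eq_bigl do rewrite inE; under eq_bigr do under eq_bigl do rewrite inE.
move=> ->.
under [X in n * X]eq_bigl do rewrite inE.
under [X in n * X]eq_bigr do under eq_bigl do rewrite inE.
rewrite /mean -mulr_suml; have n0 := vertex_neq0; by field; rewrite ?n0.
Qed.

Variable m : nat.
Local Notation M := (m.+1%:R : R).
Let D : R := #|label G m|%:R.

Lemma D_neq0 : D != 0.
Proof. by rewrite pnatr_eq0 -lt0n label_gt0. Qed.

Lemma e_between_blowupR (X Y : {set G}) :
  (e_between (G := blowup G m) [set u | u.1 \in X] [set v | v.1 \in Y])%:R =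
  (1 - M^-1) * D ^+ 2 * \sum_(x in X) \sum_(y in Y) W x y * codegree W x y.
Proof.
have M0 : M != 0 by rewrite pnatr_eq0.
have := congr1 (fun k => k%:R : R) (e_between_blowup m X Y).
rewrite !natrM sum_common => E.
apply: (mulfI (mulf_neq0 M0 vertex_neq0)).
rewrite [LHS]E.
have -> : m%:R = M - 1 by rewrite -natr1 addrK.
by rewrite -/D; move: M0; move: (M) => M' M0; field.
Qed.

Lemma card_blowup : #|blowup G m|%:R = n * D.
Proof. by rewrite -natrM; congr (_%:R); apply: card_prod. Qed.

(** The factor is the probability that two labels have distinct positions. *)
Lemma hom_density_K2_blowup :
  hom_density R K2 (blowup G m) = (1 - M^-1) * hom_density R K3 G.
Proof.
have HE : (nb_hom K2 (blowup G m))%:R =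
    (e_between (G := blowup G m) [set u | u.1 \in setT] [set v | v.1 \in setT])%:R :> R.
  have setTE : [set u : blowup G m | u.1 \in setT] = setT by apply/setP => u; rewrite !inE.
  rewrite setTE nb_hom_K2 /e_between card_set_sum pair_bigA/=; congr (_%:R).
  by apply: eq_bigr => u _; rewrite !inE.
rewrite hom_density_K3 /hom_density HE e_between_blowupR card_ord card_blowup.
under eq_bigl do rewrite inE; under eq_bigr do under eq_bigl do rewrite inE.
rewrite /mean -mulr_suml.
have n0 := vertex_neq0; have D0 := D_neq0; have M0 : M != 0 by rewrite pnatr_eq0.
by move: M0; move: (M) => M' M0; field; rewrite n0 D0 M0.
Qed.

(** The error term bounds the proportion of non-injective position maps, by [ffact_lower]. *)
Lemma hom_density_blowup (F : sgraph) :
  hom_density R F (blowup G m) <= hom_density R (triangle F) G + #|F|%:R ^+ 2 / M.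
Proof.
have n0 : 0 < n by rewrite ltr0n vertex_gt0.
have M0 : 0 < M by rewrite ltr0n.
set k := #|F|.
pose D' : R := #|G|%:R ^+ m.+1.
have D0 : 0 < D' by rewrite exprn_gt0.
pose f : R := (m.+1 ^_ k)%:R.
have fle : f <= M ^+ k by rewrite -natrX ler_nat ffact_le_expn.
have Mf : M * (M ^+ k - f) <= k%:R ^+ 2 * M ^+ k.
  have := ffact_lower m.+1 k; rewrite -(ler_nat R) natrD !natrM natrX -/f; lra.
have tcard : #|triangle F| = (k + nb_edges F)%N.
  by rewrite card_sum card_sig.
rewrite /hom_density card_blowup tcard -/k /D card_label natrM natrX -/D'.
have := nb_hom_blowup G m F.
rewrite -(ler_nat R) natrD !natrM natrB ?ffact_le_expn// !natrX -/k -/f -/D'.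
set N : R := (nb_hom F _)%:R; set T : R := (nb_hom _ _)%:R; set e := nb_edges F.
move=> main; rewrite !exprMn exprD.
have nk0 : 0 < n ^+ k by rewrite exprn_gt0.
have ne0 : 0 < n ^+ e by rewrite exprn_gt0.
have Dk0 : 0 < D' ^+ k by rewrite exprn_gt0.
have Mk0 : 0 < M ^+ k by rewrite exprn_gt0.
rewrite ler_pdivrMr ?mulr_gt0// -(ler_pM2l ne0); apply: le_trans main _.
have -> : n ^+ e * ((T / (n ^+ k * n ^+ e) + k%:R ^+ 2 / M) * (n ^+ k * (M ^+ k * D' ^+ k)))
  = M ^+ k * (D' ^+ k * T) + k%:R ^+ 2 * M ^+ k / M * (n ^+ e * (n ^+ k * D' ^+ k)).
  move: (n ^+ k) nk0 (n ^+ e) ne0 (M ^+ k) (D' ^+ k) (M) M0 => a a0 b b0 g h M' M0.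
  by field; rewrite !lt0r_neq0.
apply: lerD; rewrite ler_wpM2r ?mulr_ge0 ?ler0n ?(ltW Dk0) ?(ltW ne0) ?(ltW nk0)//.
by rewrite ler_pdivlMr// mulrC.
Qed.

(** Quasirandomness is tested on unions of fibres and passed to weights by [cut_bound]; [M^-1] pays
    for the pairs of labels with equal positions. *)
Lemma blowup_quasirandom_codegree (q eps : R) :
  quasirandom eps q (blowup G m) ->
  forall al be : G -> R, unit_fun al -> unit_fun be ->
  `|\mean_x \mean_y al x * be y * (W x y * codegree W x y - q)| <= eps + M^-1.
Proof.
move=> qr al be al01 be01.
have n0 : 0 < n by rewrite ltr0n vertex_gt0.
have D0 : 0 < D by rewrite ltr0n label_gt0.
have M0 : 0 < M by rewrite ltr0n.
have -> : (\mean_x \mean_y al x * be y * (W x y * codegree W x y - q)) =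
    (\sum_x \sum_y al x * be y * (W x y * codegree W x y - q)) / n ^+ 2.
  by rewrite /mean -mulr_suml; field; rewrite lt0r_neq0.
rewrite normrM normfV (ger0_norm (sqr_ge0 n)) ler_pdivrMr ?exprn_gt0//.
apply: cut_bound => // X Y.
set U := \sum_(x in X) \sum_(y in Y) W x y * codegree W x y.
have -> : \sum_(x in X) \sum_(y in Y) (W x y * codegree W x y - q) = U - q * #|X|%:R * #|Y|%:R.
  under eq_bigr do rewrite sumrB sumr_const.
  by rewrite sumrB sumr_const -mulrnA -mulrA -natrM mulr_natr mulnC.
have U01 : 0 <= U <= n ^+ 2.
  have t01 x y : 0 <= W x y * codegree W x y <= 1.
    by apply: unit_mul; [exact: W01 | apply: codegree01 => //; [exact: vertex_gt0|exact: W01]].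
  apply/andP; split.
    by apply: sumr_ge0 => x _; apply: sumr_ge0 => y _; case/andP: (t01 x y).
  apply: (@le_trans _ _ (\sum_(x : G) \sum_(y : G) 1)).
    rewrite /U big_mkcond/=; apply: ler_sum => x _; case: ifP => _; last first.
      by apply: sumr_ge0 => y _.
    rewrite big_mkcond/=; apply: ler_sum => y _; case: ifP => _ //.
    by case/andP: (t01 x y).
  by rewrite !sumr_const -mulrnA -natrX expnS expn1.
have := qr [set u | u.1 \in X] [set v | v.1 \in Y].
rewrite e_between_blowupR card_blowup -/U.
have cardX (Z : {set G}) : #|[set u : blowup G m | u.1 \in Z]|%:R = #|Z|%:R * D.
  rewrite (_ : [set u : blowup G m | u.1 \in Z] = setX Z setT); last first.
    by apply/setP => u; rewrite !inE andbT.
  by rewrite cardsX natrM cardsT.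
rewrite !cardX.
have -> : (1 - M^-1) * D ^+ 2 * U - q * (#|X|%:R * D) * (#|Y|%:R * D) =
    ((1 - M^-1) * U - q * #|X|%:R * #|Y|%:R) * D ^+ 2 by ring.
rewrite normrM (ger0_norm (sqr_ge0 D)) exprMn [eps * _]mulrA ler_pM2r ?exprn_gt0// => H.
have -> : U - q * #|X|%:R * #|Y|%:R = ((1 - M^-1) * U - q * #|X|%:R * #|Y|%:R) + M^-1 * U.
  by ring.
apply: le_trans (ler_normD _ _) _; rewrite [leRHS]mulrDl lerD//.
have /andP[U0 U1] := U01.
by rewrite ger0_norm ?mulr_ge0 ?invr_ge0 ?ler0n// ler_wpM2l ?invr_ge0 ?ler0n.
Qed.

Lemma quasirandom_of_codegree (c e p s eps : R) :
  0 < p <= 1 -> c = p ^+ 3 -> 0 < s <= 1 -> 0 < eps ->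
  19 * e <= c ^+ 5 * s ^+ 2 -> 20 * s <= eps ^+ 2 -> 8 * s <= eps * p ^+ 2 ->
  (forall al be : G -> R, unit_fun al -> unit_fun be ->
   `|\mean_x \mean_y al x * be y * (W x y * codegree W x y - c)| <= e) ->
  quasirandom eps p G.
Proof.
move=> p01 cE s01 eps0 es se1 se2 cut X Y.
have c01 : 0 < c <= 1.
  by have /andP[p0 p1] := p01; rewrite cE exprn_gt0//= exprn_ile1// ltW.
have ind (Z : {set G}) : unit_fun (fun x => (x \in Z)%:R : R).
  by move=> x; rewrite ler0n lern1 leq_b1.
have := W_quasirandom (vertex_gt0 G) W_sym W01 c01 cut p01 cE s01 es (ind X) (ind Y)
  se1 se2 eps0.
have n0 : 0 < n by rewrite ltr0n vertex_gt0.
rewrite e_between_sum.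
have -> : (\mean_y (y \in Y)%:R * \mean_x (x \in X)%:R * (W x y - p)) =
  (\sum_(x in X) \sum_(y in Y) W x y - p * #|X|%:R * #|Y|%:R) / n ^+ 2.
  have -> : \sum_(x in X) \sum_(y in Y) W x y - p * #|X|%:R * #|Y|%:R =
     \sum_(y in Y) \sum_(x in X) (W x y - p).
    under [RHS]eq_bigr do rewrite sumrB sumr_const.
    by rewrite sumrB sumr_const exchange_big/= -mulrnA -mulrA -natrM mulr_natr.
  rewrite /mean expr2 invfM mulrA [X in _ = X / _]mulr_suml; congr (_ / _).
  rewrite [RHS]big_mkcond/=; apply: eq_bigr => y _.
  case: (y \in Y); rewrite ?mul0r// mul1r; congr (_ / _).
  rewrite [RHS]big_mkcond/=; apply: eq_bigr => x _.
  by case: (x \in X); rewrite ?mul0r ?mul1r.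
by rewrite normrM normfV (ger0_norm (sqr_ge0 n)) ler_pdivrMr ?exprn_gt0.
Qed.

Lemma hom_density_le1 (F : sgraph) : hom_density R F G <= 1.
Proof.
rewrite /hom_density ler_pdivrMr ?exprn_gt0 ?ltr0n ?vertex_gt0// mul1r -natrX ler_nat.
by rewrite -card_ffun max_card.
Qed.

End Transfer.

(** * Choice of the parameters and conclusion *)

Theorem corollary1p4 (R : realType) (F : sgraph) :
  forcing R K2 F -> forcing R K3 (triangle F).
Proof.
move=> forceF p eps p01 eps0; have /andP[p0 p1] := p01.
(* The target density of the blow-up: [p ^+ 3] is the threshold for [K3], and
   [p ^+ (3 * nb_edges F)] is [c ^+ nb_edges F]. *)
pose c := p ^+ 3.
have c0 : 0 < c by rewrite exprn_gt0.
have c1 : c <= 1 by rewrite exprn_ile1// ltW.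
have p2 : 0 < p ^+ 2 by rewrite exprn_gt0.
(* The largest [s <= 1] meeting both conditions of [W_quasirandom]. *)
pose s := Num.min 1 (Num.min (eps ^+ 2 / 20) (eps * p ^+ 2 / 8)).
have s0 : 0 < s by rewrite !lt_min ltr01 !divr_gt0 ?mulr_gt0 ?exprn_gt0.
have s1 : s <= 1 by rewrite ge_min lexx.
have se1 : 20 * s <= eps ^+ 2.
  have : s <= eps ^+ 2 / 20 by rewrite !ge_min lexx orbT.
  lra.
have se2 : 8 * s <= eps * p ^+ 2.
  have : s <= eps * p ^+ 2 / 8 by rewrite !ge_min lexx !orbT.
  lra.
pose e := c ^+ 5 * s ^+ 2 / 19.
have e0 : 0 < e by rewrite divr_gt0 ?mulr_gt0 ?exprn_gt0.
have e20 : 0 < e / 2 by rewrite divr_gt0.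
have c01 : 0 < c <= 1 by rewrite c0.
(* Half of [e] goes to the forcing hypothesis, half to the [m.+1%:R^-1] lost in passing back from
   the blow-up. *)
have [dlt dlt0 forceH] := forceF c (e / 2) c01 e20.
pose Q := c ^+ nb_edges F.
have Q0 : 0 < Q by rewrite exprn_gt0.
pose k2 : R := #|F|%:R ^+ 2.
have k20 : 0 <= k2 by rewrite sqr_ge0.
(* Bounds [m.+1%:R^-1] by what is available for the cut norm, for the edge density and for the
   density of [F]; [k2 + 1] makes the denominator visibly positive. The resulting [m] does not
   depend on [G]. *)
pose t := Num.min (e / 2) (Num.min (dlt / 2 * c) (dlt / 2 * Q / (k2 + 1))).
have k21 : 0 < k2 + 1 by rewrite ltr_wpDl.
have d20 : 0 < dlt / 2 by rewrite divr_gt0.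
have t0 : 0 < t.
  by rewrite !lt_min e20 mulr_gt0//= divr_gt0// mulr_gt0.
have [m mt] : exists m : nat, m.+1%:R^-1 <= t.
  exists (Num.truncn t^-1); rewrite invf_ple ?posrE ?ltr0n//.
  exact/ltW/truncnS_gt.
have te : m.+1%:R^-1 <= e / 2 by apply: le_trans mt _; rewrite ge_min lexx.
have tc : m.+1%:R^-1 <= dlt / 2 * c.
  by apply: le_trans mt _; rewrite !ge_min lexx orbT.
have tQ : k2 / m.+1%:R <= dlt / 2 * Q.
  apply: (@le_trans _ _ ((k2 + 1) / m.+1%:R)).
    by rewrite ler_wpM2r ?invr_ge0 ?ler0n// lerDl.
  rewrite mulrC -ler_pdivlMr//.
  by apply: le_trans mt _; rewrite !ge_min lexx !orbT.
(* The other half of [dlt] absorbs the errors of the blow-up in both densities. *)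
exists (dlt / 2) => //.
move=> G; rewrite nb_edges_K3 nb_edges_triangle exprM -/c -/Q => hK3 hF.
apply: (quasirandom_of_codegree (c := c) (e := e) (s := s)) => //; rewrite ?s0//.
  by rewrite /e mulrC divfK ?pnatr_eq0.
move=> al be al01 be01.
have M0 : 0 <= m.+1%:R^-1 :> R by rewrite invr_ge0 ler0n.
apply: (@le_trans _ _ (e / 2 + m.+1%:R^-1)); last by rewrite [leRHS]splitr lerD2l.
apply: blowup_quasirandom_codegree al01 be01.
apply: forceH.
  rewrite nb_edges_K2 expr1 hom_density_K2_blowup.
  have := hom_density_le1 R G K3; set tK := hom_density _ _ _ in hK3 * => tK1.
  have : m.+1%:R^-1 * tK <= m.+1%:R^-1 by rewrite ler_piMr.
  by move: tc; set r := m.+1%:R^-1 => tc; lra.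
rewrite -/Q; apply: le_trans (hom_density_blowup _ _ _ _) _; rewrite -/k2.
by move: tQ; set r := k2 / _ => tQ; lra.
Qed.
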